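(* Let $\mathbb F$ be a finite field and let $\mathcal Z$ be the universal cubic space over $\mathbb F$. For any open subgroup $H\subset\mathrm{Isoc}(\mathcal Z)$ there is a finite-dimensional linear subspace $V\subset\mathcal Z$ such that $$K(V)\subset H\subset K^\circ(V).$$
   Context: A cubic space over $\mathbb F$ is a linear space $V$ over $\mathbb F$ with a symmetric trilinear form $\varpi_V:V\times V\times V\to\mathbb F$. An isocubic embedding $V\to W$ is an injective linear map $\iota$ with $\varpi_W(\iota v_1,\iota v_2,\iota v_3)=\varpi_V(v_1,v_2,v_3)$. $\mathrm{Isoc}(V)$ is the group of all invertible linear operators of $V$ preserving $\varpi_V$. The universal cubic space $\mathcal Z$ is the cubic space of countably infinite dimension over $\mathbb F$ (it exists and is unique up to isomorphism) with the Urysohn extension property: for any finite-dimensional cubic space $W$ and any subspace $V\subset W$ of codimension $1$ (with the restricted form), any isocubic embedding $V\to\mathcal Z$ extends to an isocubic embedding $W\to\mathcal Z$. $\mathrm{Isoc}(\mathcal Z)$ is a closed subgroup of the group $S(\mathcal Z)$ of all permutations of the countable set $\mathcal Z$, with the topology of pointwise convergence ($\mathcal Z$ discrete). For a finite-dimensional subspace $V\subset\mathcal Z$, $K(V)\subset\mathrm{Isoc}(\mathcal Z)$ is the subgroup fixing all elements of $V$, and $K^\circ(V)\subset\mathrm{Isoc}(\mathcal Z)$ is the subgroup of elements sending $V$ to itself. The subgroups $K(V)$ are open and form a fundamental system of neighborhoods of the unit. *)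

(* Defs.v *)
From HB Require Import structures.
From mathcomp Require Import all_boot all_order all_algebra.
From mathcomp Require Import all_classical topology.

Set Implicit Arguments.
Unset Strict Implicit.
Unset Printing Implicit Defensive.

Import GRing.Theory.
Local Open Scope ring_scope.
Local Open Scope classical_set_scope.

Definition trilinear_form (F : fieldType) (V : lmodType F)
    (w : V -> V -> V -> F) : Prop :=
  [/\ forall y z, scalar (fun x => w x y z),
      forall x z, scalar (fun y => w x y z) &
      forall x y, scalar (fun z => w x y z)].

(* The two transpositions below generate the symmetric group on the three
   arguments. *)
Definition symmetric_form (F : fieldType) (V : lmodType F)
    (w : V -> V -> V -> F) : Prop :=
  (forall x y z, w x y z = w y x z) /\ (forall x y z, w x y z = w x z y).

(* A cubic space is a pair [V], [w : cubic_form V]. *)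
Record cubic_form (F : fieldType) (V : lmodType F) := CubicForm {
  cubic_fun :> V -> V -> V -> F;
  cubic_trilinear : trilinear_form cubic_fun;
  cubic_symmetric : symmetric_form cubic_fun }.

Section Restriction.
Variables (F : fieldType) (W : vectType F) (w : cubic_form W) (V : {vspace W}).

Definition restr_fun (x y z : subvs_of V) : F := w (vsval x) (vsval y) (vsval z).

Fact restr_trilinear : trilinear_form restr_fun.
Proof.
case: (cubic_trilinear w) => w1 w2 w3.
by split=> x y a u v; rewrite /restr_fun linearP ?(w1, w2, w3).
Qed.

Fact restr_symmetric : symmetric_form restr_fun.
Proof. by case: (cubic_symmetric w) => wC wA; split=> x y z; [apply: wC | apply: wA]. Qed.

Definition restr_form : cubic_form (subvs_of V) :=
  CubicForm restr_trilinear restr_symmetric.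

End Restriction.

Definition preserves_form (F : fieldType) (V W : lmodType F)
    (v : cubic_form V) (w : cubic_form W) (f : V -> W) : Prop :=
  forall x y z, w (f x) (f y) (f z) = v x y z.

Definition isocubic_embedding (F : fieldType) (V W : lmodType F)
    (v : cubic_form V) (w : cubic_form W) (f : V -> W) : Prop :=
  [/\ linear f, injective f & preserves_form v w f].

Definition countable_basis (F : fieldType) (Z : lmodType F)
    (e : nat -> Z) : Prop :=
  (forall n (c : 'I_n -> F),
      \sum_(i < n) c i *: e i = 0 -> forall i, c i = 0) /\
  (forall x, exists n (c : 'I_n -> F), x = \sum_(i < n) c i *: e i).

Definition countably_infinite_dim (F : fieldType) (Z : lmodType F) : Prop :=
  exists e : nat -> Z, countable_basis e.

Definition urysohn_extension (F : fieldType) (Z : lmodType F)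
    (w : cubic_form Z) : Prop :=
  forall (W : vectType F) (wW : cubic_form W) (V : {vspace W}),
    \dim {:W} = (\dim V).+1 ->
  forall f : subvs_of V -> Z, isocubic_embedding (restr_form wW V) w f ->
  exists g : W -> Z, isocubic_embedding wW w g /\
    forall x : subvs_of V, g (vsval x) = f x.

Definition universal_cubic (F : fieldType) (Z : lmodType F)
    (w : cubic_form Z) : Prop :=
  countably_infinite_dim Z /\ urysohn_extension w.

Definition Isoc (F : fieldType) (Z : lmodType F) (w : cubic_form Z) :
    set (Z -> Z) :=
  [set g | [/\ linear g, bijective g & preserves_form w w g]].

Definition isoc_subgroup (F : fieldType) (Z : lmodType F) (w : cubic_form Z)
    (H : set (Z -> Z)) : Prop :=
  [/\ H `<=` Isoc w, H idfun,
      forall g h, H g -> H h -> H (g \o h) &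
      forall g g', H g -> cancel g g' -> cancel g' g -> H g'].

(* Relative topology on [Isoc w] inherited from [Z ^ Z]; on the permutations
   of [Z] pointwise convergence is the topology induced from [Z ^ Z]. *)
Definition isoc_open (F : fieldType) (Z : lmodType F) (w : cubic_form Z)
    (H : set (Z -> Z)) : Prop :=
  exists2 U : set {ptws Z -> discrete_topology Z}, open U & H = U `&` Isoc w.

Definition findim_subspace (F : fieldType) (Z : lmodType F) (V : set Z) :
    Prop :=
  submod_closed (mem V) /\
  exists (n : nat) (b : 'I_n -> Z), (forall i, V (b i)) /\
    forall x, V x -> exists c : 'I_n -> F, x = \sum_(i < n) c i *: b i.

Definition pointwise_stab (F : fieldType) (Z : lmodType F) (w : cubic_form Z)
    (V : set Z) : set (Z -> Z) :=
  [set g | Isoc w g /\ forall x, V x -> g x = x].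

Definition setwise_stab (F : fieldType) (Z : lmodType F) (w : cubic_form Z)
    (V : set Z) : set (Z -> Z) :=
  [set g | Isoc w g /\ g @` V = V].

(* Main.v *)
Require Import Defs.
From HB Require Import structures.
From mathcomp Require Import all_boot all_order all_algebra.
From mathcomp Require Import all_classical topology.
From mathcomp Require Import ring.

Set Implicit Arguments.
Unset Strict Implicit.
Unset Printing Implicit Defensive.

Import GRing.Theory.
Local Open Scope ring_scope.
Local Open Scope classical_set_scope.

(** Finite-dimensional partial isometries of [Z] extend to elements of [Isoc w],
    by back and forth on a countable basis.  If the pointwise stabilizers of [V]
    and [W] lie in a subgroup [H], so does that of [V :&: W]: for [h] fixing
    [V :&: W] with [h V] meeting [V] only in [V :&: W], amalgamation yields one
    copy of [W] in the same position relative to [V] as [W] and relative to [h V]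
    as [h W], so that [h] is reached from the identity by moves that each fix
    [V] or [W]; a general [h] is a quotient of two such, through a generic copy
    of [V].  Hence a subspace of least dimension whose pointwise stabilizer lies
    in the open subgroup [H] is contained in all its [H]-translates, and so is
    [H]-invariant. *)

(** * Injective linear maps in finite dimension *)

Section LinearMaps.
Variable F : fieldType.

Lemma linear_bundle (V W : lmodType F) (f : V -> W) :
  linear f -> exists g : {linear V -> W}, g = f :> (V -> W).
Proof.
move=> lf.
pose g : {linear V -> W} := HB.pack f (GRing.isLinear.Build F V W *:%R f lf).
by exists g.
Qed.

Lemma linear_injP (V W : lmodType F) (f : {linear V -> W}) :
  (forall x, f x = 0 -> x = 0) -> injective f.
Proof.
move=> f0 x y fxy; apply/eqP; rewrite -subr_eq0; apply/eqP/f0.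
by rewrite linearB fxy subrr.
Qed.

Lemma linear_inj0 (V W : lmodType F) (f : {linear V -> W}) x :
  injective f -> f x = 0 -> x = 0.
Proof. by move=> finj fx; apply: finj; rewrite fx linear0. Qed.

Lemma linear_lift (T X Z : lmodType F) (i : {linear X -> Z})
    (f : {linear T -> Z}) :
  injective i -> (forall t, exists x, i x = f t) ->
  exists l : {linear T -> X}, forall t, i (l t) = f t.
Proof.
move=> iinj /choice[l lE].
have /linear_bundle[l' l'E] : linear l.
  by move=> k x y; apply: iinj; rewrite linearP !lE linearP.
by exists l' => t; rewrite l'E.
Qed.

Lemma lker0_linfun (X T : vectType F) (l : {linear X -> T}) :
  injective l -> lker (linfun l) == 0%VS.
Proof. by move=> linj; apply/lker0P => x y; rewrite !lfunE; apply: linj. Qed.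

Lemma linear_retract (X T : vectType F) (l : {linear X -> T}) :
  injective l -> exists r : {linear T -> X}, cancel l r.
Proof.
move=> /lker0_linfun linj; exists ((linfun l)^-1)%VF => x /=.
by rewrite -[l x]lfunE lker0_lfunK.
Qed.

Lemma dim_limg_linfun (X T : vectType F) (l : {linear X -> T}) :
  injective l -> \dim (limg (linfun l)) = \dim {:X}.
Proof. by move=> /lker0_linfun/eqP l0; rewrite limg_dim_eq // l0 capv0. Qed.

Lemma dim_pair (X Y : vectType F) :
  \dim {: (X * Y)%type} = (\dim {:X} + \dim {:Y})%N.
Proof. by rewrite !dimvf. Qed.

(** Replaces an arbitrary finite-dimensional space by row vectors, so that a subspace of [Z] can be
    recorded by a number and a map. *)
Lemma rV_vect_bij (T : vectType F) :
  exists r : {linear 'rV[F]_(\dim {:T}) -> T}, bijective r.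
Proof.
pose b := vbasis {:T}.
have /linear_bundle[r rE] : linear (fun v : 'rV[F]_(\dim {:T}) =>
    \sum_(i < \dim {:T}) v 0 i *: b`_i).
  move=> k u v; rewrite scaler_sumr -big_split; apply: eq_bigr => i _.
  by rewrite !mxE scalerDl scalerA.
exists r; exists (fun t => \row_i coord b i t) => [v|t]; rewrite rE.
  apply/rowP => i; rewrite mxE coord_sum_free //.
  exact: basis_free (vbasisP _).
rewrite [RHS](coord_vbasis (memvf t)); apply: eq_bigr => i _.
by rewrite mxE.
Qed.

End LinearMaps.

(** * Operations on cubic forms and extension of embeddings in any codimension *)

Section CubicForms.
Variable F : fieldType.

Section Operations.
Variable V : lmodType F.

Lemma pull_trilinear (Z : lmodType F) (w : cubic_form Z) (f : {linear V -> Z}) :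
  trilinear_form (fun x y z => w (f x) (f y) (f z)).
Proof.
case: (cubic_trilinear w) => w1 w2 w3.
by split=> x y a u v; rewrite linearP ?(w1, w2, w3).
Qed.

Lemma pull_symmetric (Z : lmodType F) (w : cubic_form Z) (f : {linear V -> Z}) :
  Defs.symmetric_form (fun x y z => w (f x) (f y) (f z)).
Proof.
by case: (cubic_symmetric w) => wC wA; split=> x y z; [apply: wC | apply: wA].
Qed.

Definition pull_form (Z : lmodType F) (w : cubic_form Z) (f : {linear V -> Z}) :=
  CubicForm (pull_trilinear w f) (pull_symmetric w f).

Variables s t : cubic_form V.

Lemma add_trilinear : trilinear_form (fun x y z => s x y z + t x y z).
Proof.
case: (cubic_trilinear s) (cubic_trilinear t) => s1 s2 s3 [t1 t2 t3].
by split=> x y a u v; rewrite ?(s1, s2, s3) ?(t1, t2, t3) mulrDr addrACA.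
Qed.

Lemma add_symmetric : Defs.symmetric_form (fun x y z => s x y z + t x y z).
Proof.
case: (cubic_symmetric s) (cubic_symmetric t) => sC sA [tC tA].
by split=> x y z; [rewrite sC tC | rewrite sA tA].
Qed.

Definition add_form := CubicForm add_trilinear add_symmetric.

Lemma sub_trilinear : trilinear_form (fun x y z => s x y z - t x y z).
Proof.
case: (cubic_trilinear s) (cubic_trilinear t) => s1 s2 s3 [t1 t2 t3].
by split=> x y a u v;
  rewrite ?(s1, s2, s3) ?(t1, t2, t3) mulrBr opprD addrACA.
Qed.

Lemma sub_symmetric : Defs.symmetric_form (fun x y z => s x y z - t x y z).
Proof.
case: (cubic_symmetric s) (cubic_symmetric t) => sC sA [tC tA].
by split=> x y z; [rewrite sC tC | rewrite sA tA].
Qed.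

Definition sub_form := CubicForm sub_trilinear sub_symmetric.
End Operations.

Variables (Z : lmodType F) (w : cubic_form Z).
Hypothesis uryw : urysohn_extension w.

(** The one-step extension property for the codimension-one subspace [X * 0] of [X * F], phrased
    with maps so that it can be iterated. *)
Lemma urysohn_pair (X : vectType F) (t : cubic_form (X * F^o)%type)
    (f : {linear X -> Z}) :
  injective f ->
  (forall x y z, t (x, 0) (y, 0) (z, 0) = w (f x) (f y) (f z)) ->
  exists g : {linear (X * F^o)%type -> Z},
    isocubic_embedding t w g /\ forall x, g (x, 0) = f x.
Proof.
move=> finj ft.
have /linear_bundle[in1 in1E] : linear (fun x : X => (x, 0) : X * F^o).
  by move=> k x y; congr (_, _); rewrite /= scaler0 addr0.
have in1inj : injective in1 by rewrite in1E => x y [].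
pose V := limg (linfun in1).
have VP (v : subvs_of V) : vsval v = ((vsval v).1, 0).
  have /memv_imgP[x _ ->] := subvsP v.
  by rewrite lfunE in1E.
have dV : \dim {: (X * F^o)%type} = (\dim V).+1.
  by rewrite dim_limg_linfun // dim_pair !dimvf addn1.
have fV : isocubic_embedding (restr_form t V) w
    (fun v : subvs_of V => f (vsval v).1).
  split.
  - by move=> k x y; rewrite -linearP; congr (f _); rewrite linearP.
  - by move=> x y /finj xy; apply: val_inj; rewrite /= VP xy -VP.
  - by move=> x y z /=; rewrite /restr_fun /= (VP x) (VP y) (VP z) ft.
have [g [[glin ginj gt] gV]] := uryw dV fV; have [g' g'E] := linear_bundle glin.
exists g'; rewrite g'E; split=> // x.
have xV : (x, 0) \in V by apply/memv_imgP; exists x; rewrite ?memvf ?lfunE ?in1E.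
by have := gV (vsproj V (x, 0)); rewrite !vsprojK.
Qed.

(** Induction on the codimension of the image of [l]: a vector of [T] outside this image is adjoined
    to [X], and [urysohn_pair] extends [f] to it. *)
Lemma urysohn_lift (X T : vectType F) (t : cubic_form T)
    (l : {linear X -> T}) (f : {linear X -> Z}) :
  injective l -> injective f ->
  (forall x y z, t (l x) (l y) (l z) = w (f x) (f y) (f z)) ->
  exists g : {linear T -> Z},
    isocubic_embedding t w g /\ forall x, g (l x) = f x.
Proof.
move=> linj.
have [k] := ubnP (\dim {:T} - \dim {:X}); elim: k => // k IH in X l linj f * => dk.
move=> finj ft; have dl := dim_limg_linfun linj.
have [lfull|] := boolP (limg (linfun l) == fullv).
  have lVK x : l ((linfun l)^-1%VF x) = x.
    by rewrite -[l _]lfunE limg_lfunVK // (eqP lfull) memvf.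
  have [g gE] : exists g : {linear T -> Z}, g = f \o (linfun l)^-1%VF :> (T -> Z).
    by apply: linear_bundle => c x y /=; rewrite !linearP.
  exists g; split; last first.
    by move=> x; rewrite gE /= -[l x]lfunE lker0_lfunK // lker0_linfun.
  rewrite gE; split=> [c x y|x y /= /finj exy|x y z /=].
  - by rewrite /= !linearP.
  - by rewrite -(lVK x) exy lVK.
  - by rewrite -ft !lVK.
rewrite eqEsubv subvf /= => /subvPn[v _ vl].
have [l' l'E] : exists l' : {linear (X * F^o)%type -> T},
    l' = (fun p => l p.1 + (p.2 : F) *: v) :> (X * F^o -> T).
  apply: linear_bundle => c x y /=.
  by rewrite linearP scalerDl scalerDr scalerA addrACA.
have l'inj : injective l'.
  apply: linear_injP => -[x c]; rewrite l'E /= => /eqP; rewrite addr_eq0 => /eqP lx.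
  have c0 : c = 0.
    apply/eqP; apply: contraNT vl => c0.
    have -> : v = l (- c^-1 *: x) by rewrite linearZ /= lx scalerN scaleNr opprK scalerK.
    by rewrite -[l _]lfunE memv_img ?memvf.
  move: lx; rewrite c0 scale0r oppr0 => /linear_inj0 -> //.
have [|g [[gl ginj gt] gf]] := urysohn_pair (t := pull_form t l') finj.
  by move=> x y z /=; rewrite l'E /= !scale0r !addr0 ft.
have dX' : (\dim {:T} - \dim {: (X * F^o)%type} < k)%N.
  have := dimvS (subvf (limg (linfun l'))).
  rewrite dim_limg_linfun // dim_pair [\dim {:F^o}]dimvf addn1 => dXT.
  by rewrite subnS prednK ?subn_gt0 // -ltnS.
have [|h [hemb hg]] := IH _ l' l'inj g dX' ginj.
  by move=> x y z; rewrite gt.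
exists h; split=> // x; have := hg (x, 0); rewrite gf l'E /=.
by rewrite scale0r addr0.
Qed.

End CubicForms.

(** * Exhaustion of a space by the spans of initial basis vectors *)

Section CountableBasis.
Variables (F : fieldType) (Z : lmodType F) (e : nat -> Z).

Definition basis_map N (v : 'rV[F]_N) : Z := \sum_(i < N) v 0 i *: e i.

Fact basis_map_linear N : linear (@basis_map N).
Proof.
move=> k u v; rewrite /basis_map scaler_sumr -big_split; apply: eq_bigr => i _.
by rewrite !mxE scalerDl scalerA.
Qed.

HB.instance Definition _ N :=
  GRing.isLinear.Build F 'rV[F]_N Z *:%R (@basis_map N) (@basis_map_linear N).

Hypothesis ebasis : countable_basis e.

Lemma basis_map_inj N : injective (@basis_map N).
Proof.
apply: (@linear_injP _ _ _ (@basis_map N)) => v v0; apply/rowP => i.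
by rewrite [RHS]mxE; apply: (ebasis.1 N (v 0)).
Qed.

Lemma basis_map_cofinal x :
  exists N, forall M, (N <= M)%N -> exists v : 'rV_M, basis_map v = x.
Proof.
have [N [c ->]] := ebasis.2 x; exists N => M leNM.
(* The coefficients are continued by zero past [N], so that every larger [M] also works. *)
pose G k : F := if insub k is Some i then c i else 0.
exists (\row_j G j).
have -> : \sum_(i < N) c i *: e i = \sum_(i < N) G i *: e i.
  by apply: eq_bigr => i _; rewrite /G valK.
rewrite (big_ord_widen _ (fun i => G i *: e i) leNM) big_mkcond /=.
apply: eq_bigr => i _; rewrite mxE; case: ifP => // /negbT leNi.
by rewrite /G insubN // scale0r.
Qed.

(** The maximum of the bounds for the images of a basis of [T] serves for all of [T].
    Finite-dimensional subspaces of [Z] can thus be handled inside one space of row vectors. *)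
Lemma basis_map_lift (T : vectType F) (f : {linear T -> Z}) :
  exists N, forall M, (N <= M)%N ->
    exists l : {linear T -> 'rV_M}, forall t, basis_map (l t) = f t.
Proof.
pose b := vbasis {:T}.
have /choice[N NP] (i : 'I_(\dim {:T})) := basis_map_cofinal (f b`_i).
exists (\max_i N i)%N => M leNM.
apply: (linear_lift (@basis_map_inj M)) => t.
have /choice[v vP] (i : 'I_(\dim {:T})) : exists v : 'rV_M, basis_map v = f b`_i.
  by apply: NP; apply: leq_trans leNM; apply: leq_bigmax.
exists (\sum_i coord b i t *: v i).
rewrite linear_sum [in RHS](coord_vbasis (memvf t)) linear_sum.
by apply: eq_bigr => i _; rewrite !linearZ /= vP.
Qed.

End CountableBasis.

Arguments basis_map {F Z} e {N} v.

(** * Homogeneity of the universal space by back and forth *)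

Section Homogeneity.
Variables (F : fieldType) (Z : lmodType F) (w : cubic_form Z).

(** An isometry between two finite-dimensional subspaces of [Z], both parametrized by the same row
    space; inverting it only swaps the two maps. *)
Record partial_iso := PartialIso {
  pi_dim : nat;
  pi_src : {linear 'rV[F]_pi_dim -> Z};
  pi_tgt : {linear 'rV[F]_pi_dim -> Z};
  pi_src_inj : injective pi_src;
  pi_tgt_inj : injective pi_tgt;
  pi_form : forall x y z, w (pi_src x) (pi_src y) (pi_src z) =
                          w (pi_tgt x) (pi_tgt y) (pi_tgt z) }.

(** Inclusion of graphs, whatever the two parametrizations are. *)
Definition pi_le (p q : partial_iso) := forall x, exists x',
  pi_src q x' = pi_src p x /\ pi_tgt q x' = pi_tgt p x.

Definition pi_swap (p : partial_iso) : partial_iso :=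
  PartialIso (@pi_tgt_inj p) (@pi_src_inj p)
    (fun x y z => esym (pi_form x y z)).

Lemma pi_le_refl p : pi_le p p.
Proof. by move=> x; exists x. Qed.

Lemma pi_le_trans q p r : pi_le p q -> pi_le q r -> pi_le p r.
Proof.
move=> pq qr x; have [y [<- <-]] := pq x; have [z [<- <-]] := qr y.
by exists z.
Qed.

Lemma pi_le_swap p q : pi_le p q -> pi_le (pi_swap p) (pi_swap q).
Proof. by move=> pq x; have [y [? ?]] := pq x; exists y. Qed.

Variable e : nat -> Z.
Hypotheses (ebasis : countable_basis e) (uryw : urysohn_extension w).

(** The old source and the first [k] basis vectors lie in the span of the first [M], which becomes
    the new source; [urysohn_lift] provides the new target map. *)
Lemma pi_forth p k : exists2 q, pi_le p q &
  forall x : 'rV_k, exists x', pi_src q x' = basis_map e x.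
Proof.
have [N NP] := basis_map_lift ebasis (pi_src p).
have [N' N'P] := basis_map_lift ebasis (basis_map e : {linear 'rV_k -> Z}).
pose M := maxn N N'.
have [l lP] := NP M (leq_maxl _ _).
have [l' l'P] := N'P M (leq_maxr _ _).
have linj : injective l.
  by move=> x y lxy; apply: (@pi_src_inj p); rewrite -!lP lxy.
have [|g [[_ ginj gw] gl]] := urysohn_lift uryw
    (t := pull_form w (basis_map e : {linear 'rV_M -> Z})) linj (@pi_tgt_inj p).
  by move=> x y z /=; rewrite !lP pi_form.
exists (@PartialIso M (basis_map e) g (@basis_map_inj _ _ _ ebasis M) ginj
  (fun x y z => esym (gw x y z))).
  by move=> x; exists (l x); rewrite /= lP gl.
by move=> x; exists (l' x); rewrite /= l'P.
Qed.

Lemma pi_back_and_forth p k : exists q, pi_le p q /\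
  forall x : 'rV_k, (exists y, pi_src q y = basis_map e x) /\
                    (exists y, pi_tgt q y = basis_map e x).
Proof.
have [q pq qk] := pi_forth p k; have [r qr rk] := pi_forth (pi_swap q) k.
exists (pi_swap r); split; first exact: pi_le_trans (pi_le_swap qr).
move=> x; split; last exact: rk.
by have [y <-] := qk x; have [z [_ zE]] := qr y; exists z.
Qed.

Lemma pi_extends p : exists2 g, Isoc w g & forall x, g (pi_src p x) = pi_tgt p x.
Proof.
have /choice[nxt nxtP] (qk : partial_iso * nat) :=
  pi_back_and_forth qk.1 qk.2.
(* Stage [n.+1] has the first [n] basis vectors in both its source and its target, so the union of
   the stages is a bijection of [Z]. *)
pose fix ch n := if n is m.+1 then nxt (ch m, m) else p.
have ch_le m n : (m <= n)%N -> pi_le (ch m) (ch n).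
  elim: n => [|n IH]; first by rewrite leqn0 => /eqP ->; apply: pi_le_refl.
  rewrite leq_eqVlt => /predU1P[-> | /IH mn]; first exact: pi_le_refl.
  by apply: pi_le_trans mn _; have [] := nxtP (ch n, n).
(* The graph of stage [n]. It grows with [n], so finitely many values can be compared at a common
   later stage, found below as a [maxn]. *)
pose gr y z n := exists2 x, pi_src (ch n) x = y & pi_tgt (ch n) x = z.
have gr_le y z m n : (m <= n)%N -> gr y z m -> gr y z n.
  by move=> /ch_le mn [x <- <-]; have [x' [? ?]] := mn x; exists x'.
have basisZ z : exists n (v : 'rV_n), basis_map e v = z.
  by have [n /(_ n (leqnn n))] := basis_map_cofinal ebasis z; exists n.
have /choice[g /choice[lg gP]] y : exists z n, gr y z n.
  have [n [v <-]] := basisZ y; have [_ /(_ v)[[x xE] _]] := nxtP (ch n, n).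
  by exists (pi_tgt (ch n.+1) x), n.+1, x.
have /choice[g' /choice[lg' g'P]] z : exists y n, gr y z n.
  have [n [v <-]] := basisZ z; have [_ /(_ v)[_ [x xE]]] := nxtP (ch n, n).
  by exists (pi_src (ch n.+1) x), n.+1, x.
have gr_fun n y z z' : gr y z n -> gr y z' n -> z' = z.
  by move=> [x <- <-] [x' /pi_src_inj -> <-].
have gr_inj n y y' z : gr y z n -> gr y' z n -> y' = y.
  by move=> [x <- <-] [x' <- /pi_tgt_inj ->].
have gE y z n : gr y z n -> g y = z.
  move=> yz; apply: (gr_fun (maxn n (lg y)) y).
    exact: gr_le (leq_maxl _ _) yz.
  exact: gr_le (leq_maxr _ _) (gP y).
have g'E y z n : gr y z n -> g' z = y.
  move=> yz; apply: (gr_inj (maxn n (lg' z)) _ _ z).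
    exact: gr_le (leq_maxl _ _) yz.
  exact: gr_le (leq_maxr _ _) (g'P z).
have gP' y n : (lg y <= n)%N -> gr y (g y) n by move=> /gr_le; apply.
exists g; last by move=> x; apply: (gE _ _ 0%N); exists x.
split=> [c y z| |x y z].
- have [y' y'y y'gy] := gP' y _ (leq_maxl (lg y) (lg z)).
  have [z' z'z z'gz] := gP' z _ (leq_maxr (lg y) (lg z)).
  apply: (gE _ _ (maxn (lg y) (lg z))); exists (c *: y' + z');
    by rewrite linearP ?(y'y, y'gy, z'z, z'gz).
- by exists g' => y; [apply: g'E (gP y) | apply: gE (g'P y)].
- pose n := maxn (lg x) (maxn (lg y) (lg z)).
  have [|x' <- <-] := gP' x n; first by rewrite leq_max leqnn.
  have [|y' <- <-] := gP' y n; first by rewrite !leq_max leqnn orbT.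
  have [|z' <- <-] := gP' z n; first by rewrite !leq_max leqnn !orbT.
  by rewrite pi_form.
Qed.

Lemma isoc_homogeneous (T : vectType F) (a b : {linear T -> Z}) :
  injective a -> injective b ->
  (forall x y z, w (a x) (a y) (a z) = w (b x) (b y) (b z)) ->
  exists2 g, Isoc w g & forall x, g (a x) = b x.
Proof.
move=> ainj binj ab.
have [r [s rK sK]] := rV_vect_bij T; have rinj := can_inj rK.
have [g gw gab] := pi_extends (@PartialIso _ (a \o r) (b \o r)
  (inj_comp ainj rinj) (inj_comp binj rinj) (fun x y z => ab (r x) (r y) (r z))).
by exists g => // x; have := gab (s x); rewrite /= sK.
Qed.

End Homogeneity.

(** * The isometry group and the pointwise stabilizers inside a subgroup *)

Section IsocGroup.
Variables (F : fieldType) (Z : lmodType F) (w : cubic_form Z).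

Lemma isoc_comp g h : Isoc w g -> Isoc w h -> Isoc w (g \o h).
Proof.
move=> [gl gb gw] [hl hb hw]; split.
- by move=> k x y; rewrite /= hl gl.
- exact: bij_comp.
- by move=> x y z; rewrite /= gw hw.
Qed.

Lemma isoc_inv g : Isoc w g ->
  exists2 g', Isoc w g' & cancel g g' /\ cancel g' g.
Proof.
move=> [gl [g' gK g'K] gw]; exists g' => //; split.
- by move=> k x y; apply: (can_inj gK); rewrite gl !g'K.
- by exists g.
- by move=> x y z; rewrite -gw !g'K.
Qed.

(** The subspace is given by a parametrization [a], of which only the range matters. *)
Definition contains_stab (H : set (Z -> Z)) (T : Type) (a : T -> Z) :=
  forall g, Isoc w g -> (forall t, g (a t) = a t) -> H g.

Variable H : set (Z -> Z).
Hypothesis subH : isoc_subgroup w H.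

(** The quotient of [h] by [g] fixes the range of [a]; hence membership in [H] can be tested on that
    range. *)
Lemma contains_stab_agree (T : Type) (a : T -> Z) g h :
  contains_stab H a -> H g -> Isoc w h -> (forall t, h (a t) = g (a t)) -> H h.
Proof.
case: subH => HI _ HM _ Ha Hg Ih gh.
have [g' Ig' [gK g'K]] := isoc_inv (HI _ Hg).
have -> : h = g \o (g' \o h) by apply: funext => x /=; rewrite g'K.
by apply: HM => //; apply: Ha; [apply: isoc_comp | move=> t /=; rewrite gh gK].
Qed.

(** The stabilizer of a translate by [h] is the conjugate by [h] of the stabilizer. *)
Lemma contains_stab_conj (T : Type) (a : T -> Z) h :
  contains_stab H a -> H h -> contains_stab H (h \o a).
Proof.
case: subH => HI _ HM HV Ha Hh g Ig gha.
have [h' Ih' [hK h'K]] := isoc_inv (HI _ Hh).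
have -> : g = h \o (h' \o g \o h) \o h'.
  by apply: funext => x /=; rewrite !h'K.
apply: (HM _ _ _ (HV _ _ Hh hK h'K)); apply: HM => //; apply: Ha.
  by apply: isoc_comp (HI _ Hh); apply: isoc_comp.
by move=> t /=; rewrite gha hK.
Qed.

Lemma contains_stab_sub (T T' : Type) (a : T -> Z) (b : T' -> Z) :
  contains_stab H a -> (forall t, exists t', b t' = a t) -> contains_stab H b.
Proof.
by move=> Ha ab g Ig gb; apply: Ha => // t; have [t' <-] := ab t; apply: gb.
Qed.

End IsocGroup.

(** * Pointwise stabilizers of intersections *)

Section Meet.
Variables (F : fieldType) (Z : lmodType F) (w : cubic_form Z) (e : nat -> Z).
Hypotheses (ebasis : countable_basis e) (uryw : urysohn_extension w).
Variable H : set (Z -> Z).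
Hypothesis subH : isoc_subgroup w H.

Section Amalgam.
Variables U A C : vectType F.
Variable i : {linear (U * A * C)%type -> Z}.
Hypothesis iinj : injective i.
Hypothesis HUA : contains_stab w H (fun p : U * A => i (p, 0)).
Hypothesis HUC : contains_stab w H (fun p : U * C => i (p.1, 0, p.2)).

(** Since [i (U * A)] and the [h]-image of [A] are independent, both embed in one space together
    with a copy of [C] placed relative to each of them as [C] is relative to [A]. Then [h] is
    reached by moves that fix [A] or [C] along with [U]. *)
Lemma stab_independent_move h : Isoc w h ->
  (forall u, h (i (u, 0, 0)) = i (u, 0, 0)) ->
  (forall u a a', i (u, a, 0) + h (i (0, a', 0)) = 0 ->
    [/\ u = 0, a = 0 & a' = 0]) -> H h.
Proof.
move=> Ih hU indep.
have [hl _ hw] := Ih; have [f fE] : exists f : {linear (U * A * C)%type -> Z},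
    f = h \o i :> (U * A * C -> Z).
  by apply: linear_bundle => k x y; rewrite /= linearP hl.
have fi x y z : w (f x) (f y) (f z) = w (i x) (i y) (i z) by rewrite fE hw.
have fU u : f (u, 0, 0) = i (u, 0, 0) by rewrite fE /= hU.
(* The first [A] stands for the original copy, the second for its image under [h]. *)
pose T := (U * A * A * C)%type.
have [p pE] : exists p : {linear T -> Z},
    p = (fun t => i (t.1.1.1, t.1.1.2, t.2)) :> (T -> Z).
  by apply: linear_bundle => k x y; rewrite -linearP.
have [q qE] : exists q : {linear T -> Z},
    q = (fun t => i (t.1.1.1, t.1.2, t.2)) :> (T -> Z).
  by apply: linear_bundle => k x y; rewrite -linearP.
have [r rE] : exists r : {linear T -> Z},
    r = (fun t => i (t.1.1.1, 0, t.2)) :> (T -> Z).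
  apply: linear_bundle => k x y; rewrite -linearP; congr (i (_, _, _)).
  by rewrite /= scaler0 addr0.
have [p0 p0E] : exists p : {linear T -> Z},
    p = (fun t => i (t.1.1.1, t.1.1.2, 0)) :> (T -> Z).
  apply: linear_bundle => k x y; rewrite -linearP; congr (i (_, _, _)).
  by rewrite /= scaler0 addr0.
have [q0 q0E] : exists q : {linear T -> Z},
    q = (fun t => i (t.1.1.1, t.1.2, 0)) :> (T -> Z).
  apply: linear_bundle => k x y; rewrite -linearP; congr (i (_, _, _)).
  by rewrite /= scaler0 addr0.
have [r0 r0E] : exists r : {linear T -> Z},
    r = (fun t => i (t.1.1.1, 0, 0)) :> (T -> Z).
  by apply: linear_bundle => k x y; rewrite -linearP; congr (i (_, _, _));
    rewrite /= scaler0 addr0.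
have [s sE] : exists s : {linear (U * A * A)%type -> Z},
    s = (fun t => i (t.1.1, t.1.2, 0) + f (0, t.2, 0)) :> (U * A * A -> Z).
  apply: linear_bundle => k x y; rewrite scalerDr addrACA -!linearP.
  by congr (_ + _); [congr (i (_, _, _)) | congr (f (_, _, _))];
    rewrite /= scaler0 addr0.
have sinj : injective s.
  apply: linear_injP => -[[u a] a']; rewrite sE fE /= => /indep[-> -> ->] //.
have [s' s'E] : exists s' : {linear T -> Z}, s' = s \o fst :> (T -> Z).
  by apply: linear_bundle => k x y; rewrite /= linearP.
have [l lE] : exists l : {linear (U * A * A)%type -> T},
    l = (fun x => (x, 0)) :> (U * A * A -> T).
  by apply: linear_bundle => k x y; congr (_, _); rewrite /= scaler0 addr0.
(* Inclusion-exclusion: [t] agrees with [s'] where the [C] component vanishes,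
   with [p] where the second [A] component does, and with [q] where the first
   one does. *)
pose t := add_form (sub_form (sub_form (add_form (sub_form (add_form
  (pull_form w s') (pull_form w p)) (pull_form w p0)) (pull_form w q))
  (pull_form w q0)) (pull_form w r)) (pull_form w r0).
have linj : injective l by rewrite lE => x y [].
have [|j [[jl jinj jt] js]] := urysohn_lift uryw (t := t) linj sinj.
  move=> x y z; rewrite /= s'E pE p0E qE q0E rE r0E lE /=.
  by rewrite !addrK subrK.
have [f1 f1E] : exists f1 : {linear (U * A * C)%type -> Z},
    f1 = (fun x => j (x.1, 0, x.2)) :> (U * A * C -> Z).
  apply: linear_bundle => k x y; rewrite -linearP; congr (j (_, _, _)).
  by rewrite /= scaler0 addr0.
have [f2 f2E] : exists f2 : {linear (U * A * C)%type -> Z},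
    f2 = (fun x => j (x.1.1, 0, x.1.2, x.2)) :> (U * A * C -> Z).
  apply: linear_bundle => k x y; rewrite -linearP; congr (j (_, _, _, _)).
  by rewrite /= scaler0 addr0.
have f1inj : injective f1.
  by rewrite f1E => -[[u a] c] [[u' a'] c'] /jinj[-> -> ->].
have f2inj : injective f2.
  by rewrite f2E => -[[u a] c] [[u' a'] c'] /jinj[-> -> ->].
have f000 : f (0, 0, 0) = 0 by rewrite fU linear0.
have f1i x y z : w (i x) (i y) (i z) = w (f1 x) (f1 y) (f1 z).
  case: x y z => [[u a] c] [[u' a'] c'] [[u'' a''] c''].
  rewrite f1E jt /= s'E sE pE p0E qE q0E rE r0E /= f000 !addr0; ring.
have fs u a : i (u, 0, 0) + f (0, a, 0) = f (u, a, 0).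
  by rewrite -fU -linearD; congr (f (_, _, _)); rewrite /= ?addr0 ?add0r.
have f2i x y z : w (i x) (i y) (i z) = w (f2 x) (f2 y) (f2 z).
  case: x y z => [[u a] c] [[u' a'] c'] [[u'' a''] c''].
  rewrite f2E jt /= s'E sE pE p0E qE q0E rE r0E /= !fs fi; ring.
(* [h1] fixes [i (U * A)], [h2] agrees with [h1] on the image of [U * C], and [h] agrees with [h2]
   on [i (U * A)]; membership in [H] passes along this chain. *)
have [h1 Ih1 h1E] := isoc_homogeneous ebasis uryw iinj f1inj f1i.
have [h2 Ih2 h2E] := isoc_homogeneous ebasis uryw iinj f2inj f2i.
have jsE x : j (x, 0) = s x by rewrite -js lE.
have Hh1 : H h1.
  apply: HUA => // -[u a]; rewrite h1E f1E /=.
  by rewrite jsE sE /= f000 addr0.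
have Hh2 : H h2.
  by apply: (contains_stab_agree subH HUC Hh1) => // -[u c];
    rewrite h1E h2E f1E f2E.
apply: (contains_stab_agree subH HUA Hh2) => // -[u a].
by rewrite h2E f2E /= jsE sE /= fs fE.
Qed.

(** Removes the independence condition: some [g] fixing [U] moves [A] to a copy independent of both
    [i (U * A)] and its [h]-image. The previous lemma then applies to [g] and to [h' \o g]. *)
Lemma stab_amalgam : contains_stab w H (fun u : U => i (u, 0, 0)).
Proof.
move=> h Ih hU; have [hl _ hw] := Ih.
have [h' Ih' [hK h'K]] := isoc_inv Ih.
have [f fE] : exists f : {linear (U * A * (U * A))%type -> Z},
    f = (fun x => i (x.1, 0) + h (i (x.2, 0))) :> (U * A * (U * A) -> Z).
  apply: linear_bundle => k x y; rewrite scalerDr addrACA -hl -!linearP.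
  by congr (_ + h _); congr (i (_, _)); rewrite /= scaler0 addr0.
have h0 : h 0 = 0 by have := hU 0; rewrite linear0.
have [N /(_ N (leqnn N))[l lE]] := basis_map_lift ebasis f.
have [m mE] : exists m : {linear U -> 'rV[F]_N},
    m = (fun u => l (u, 0, 0)) :> (U -> 'rV[F]_N).
  apply: linear_bundle => k x y; rewrite -linearP; congr (l (_, _, _)).
    by rewrite /= scaler0 addr0.
  by rewrite /= scaler0 addr0.
have bm u : basis_map e (m u) = i (u, 0, 0).
  by rewrite mE lE fE /= linear0 h0 addr0.
have minj : injective m.
  by move=> u u' uu'; have := bm u; rewrite uu' bm => /iinj[].
(* The kernel of [r] is a complement of [m U]. In the form [t] below, a product with one factor in
   this kernel and another in the new copy of [A * C] vanishes. *)
have [r mK] := linear_retract minj.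
pose T := ('rV[F]_N * (A * C))%type.
have [b bE] : exists b : {linear T -> Z}, b = (fun t => basis_map e t.1) :> (T -> Z).
  by apply: linear_bundle => k x y; rewrite -linearP.
have [q qE] : exists q : {linear T -> Z},
    q = (fun t => i (r t.1, t.2.1, t.2.2)) :> (T -> Z).
  by apply: linear_bundle => k x y; rewrite -linearP; congr (i (_, _, _));
     rewrite /= linearP.
have [q0 q0E] : exists q : {linear T -> Z},
    q = (fun t => i (r t.1, 0, 0)) :> (T -> Z).
  by apply: linear_bundle => k x y; rewrite -linearP; congr (i (_, _, _));
     rewrite /= ?linearP ?scaler0 ?addr0.
have [d dE] : exists d : {linear 'rV[F]_N -> T},
    d = (fun x => (x, 0)) :> ('rV[F]_N -> T).
  by apply: linear_bundle => k x y; congr (_, _); rewrite /= scaler0 addr0.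
have dinj : injective d by rewrite dE => x y [].
(* The free amalgam, over [U], of a space containing [i (U * A)] and
   [h (i (U * A))] with a new copy of [U * A * C]. *)
pose t := sub_form (add_form (pull_form w b) (pull_form w q)) (pull_form w q0).
have [|j [[_ jinj jt] jb]] := urysohn_lift uryw (t := t)
    (f := basis_map e) dinj (basis_map_inj ebasis (N := N)).
  by move=> x y z; rewrite /= bE qE q0E dE /= addrK.
have jE x : j (x, 0) = basis_map e x by rewrite -jb dE.
have [k kE] : exists k : {linear (U * A * C)%type -> Z},
    k = (fun x => j (m x.1.1, (x.1.2, x.2))) :> (U * A * C -> Z).
  by apply: linear_bundle => c x y; rewrite -linearP; congr (j (_, _));
     rewrite /= linearP.
have kinj : injective k.
  by rewrite kE => -[[u a] c] [[u' a'] c'] /jinj[/minj -> -> ->].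
have ki x y z : w (i x) (i y) (i z) = w (k x) (k y) (k z).
  case: x y z => [[u a] c] [[u' a'] c'] [[u'' a''] c''].
  rewrite kE jt /= bE qE q0E /= !mK !bm; ring.
have [g Ig gE] := isoc_homogeneous ebasis uryw iinj kinj ki.
have gU u : g (i (u, 0, 0)) = i (u, 0, 0) by rewrite gE kE /= jE bm.
have kl x a : f x + k (0, a, 0) = j (l x, (a, 0)).
  rewrite kE /= -lE -jE -linearD linear0; congr (j (_, _)).
    by rewrite /= addr0.
  by rewrite /= add0r.
(* The two summands come from different factors of [T], and [j] is injective. *)
have f0 x a : f x + k (0, a, 0) = 0 -> f x = 0 /\ a = 0.
  rewrite kl => /(linear_inj0 jinj)[lx ->].
  by rewrite -lE lx linear0.
have Hg : H g.
  apply: stab_independent_move => // u a a'; rewrite gE.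
  have <- : f (u, a, 0) = i (u, a, 0) by rewrite fE /= linear0 h0 addr0.
  move=> /f0[+ ->]; rewrite fE /= linear0 h0 addr0.
  by move=> /(linear_inj0 iinj)[-> ->].
(* Applying [h] turns a relation between [i (U * A)] and the [h' \o g]-image of [A] into one between
   [h (i (U * A))] and the [g]-image of [A], which [f0] excludes. *)
have Hhg : H (h' \o g).
  apply: stab_independent_move; first exact: isoc_comp.
    by move=> u; rewrite /= gU -[in LHS]hU hK.
  move=> u a a' /(congr1 h); rewrite -[i (u, a, 0)]scale1r hl /= h'K h0 gE scale1r.
  have <- : f (0, (u, a)) = h (i (u, a, 0)) by rewrite fE /= linear0 add0r.
  move=> /f0[+ ->]; rewrite fE /= linear0 add0r -[RHS]h0 => /(can_inj hK).
  by move=> /(linear_inj0 iinj)[-> ->].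
have [HI _ HM HV] := subH.
have [g' Ig' [gK g'K]] := isoc_inv Ig.
(* The second factor is the inverse of [h' \o g]. *)
have -> : h = g \o (g' \o h) by apply: funext => x /=; rewrite g'K.
apply: HM => //; apply: HV Hhg _ _ => x /=; first by rewrite h'K gK.
by rewrite g'K hK.
Qed.

End Amalgam.

(** Complements of the intersection in [V] and in [W], together with the intersection, form a direct
    sum; this is the setting of [stab_amalgam]. *)
Lemma stab_meet (E : vectType F) (i : {linear E -> Z}) (V W : {vspace E}) :
  injective i ->
  contains_stab w H (fun v : subvs_of V => i (vsval v)) ->
  contains_stab w H (fun v : subvs_of W => i (vsval v)) ->
  contains_stab w H (fun v : subvs_of (V :&: W)%VS => i (vsval v)).
Proof.
move=> iinj HV HW.
pose U := subvs_of (V :&: W)%VS.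
pose A := subvs_of (V :\: W)%VS; pose C := subvs_of (W :\: V)%VS.
have [f fE] : exists f : {linear (U * A * C)%type -> Z},
    f = (fun x => i (vsval x.1.1 + vsval x.1.2 + vsval x.2)) :> (U * A * C -> Z).
  apply: linear_bundle => k x y; rewrite -linearP; congr (i _).
  by rewrite !scalerDr [RHS]addrACA [X in _ = X + _]addrACA -!linearP.
have finj : injective f.
  apply: linear_injP => -[[u a] c]; rewrite fE /= => /(linear_inj0 iinj) uac0.
  have /andP[uV uW] : (vsval u \in V) && (vsval u \in W).
    by rewrite -memv_cap subvsP.
  have aV : vsval a \in V by apply: subvP (diffvSl V W) _ (subvsP a).
  have c0 : vsval c = 0.
    apply/eqP; rewrite -memv0 -(capv_diff W V) memv_cap subvsP /=.
    by move/eqP: uac0; rewrite addrC addr_eq0 => /eqP ->; rewrite rpredN rpredD.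
  have a0 : vsval a = 0.
    apply/eqP; rewrite -memv0 -(capv_diff V W) memv_cap subvsP /=.
    move/eqP: uac0; rewrite c0 addr0 addrC addr_eq0 => /eqP ->.
    by rewrite rpredN.
  have u0 : vsval u = 0 by move: uac0; rewrite a0 c0 !addr0.
  by congr (_, _, _); apply: val_inj; rewrite /= ?u0 ?a0 ?c0.
apply: (contains_stab_sub (a := fun u : U => f (u, 0, 0))).
  apply: stab_amalgam => //.
    apply: contains_stab_sub HV _ => v.
    have /memv_addP[a aA [u uU vE]] : vsval v \in (V :\: W + V :&: W)%VS.
      by rewrite addv_diff_cap subvsP.
    exists (vsproj _ u, vsproj _ a).
    by rewrite fE /= !vsprojK // addr0 addrC vE.
  apply: contains_stab_sub HW _ => v.
  have /memv_addP[a aA [u uU vE]] : vsval v \in (W :\: V + W :&: V)%VS.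
    by rewrite addv_diff_cap subvsP.
  exists (vsproj _ u, vsproj _ a).
  by rewrite fE /= !vsprojK // 1?capvC // addr0 addrC vE.
by move=> u; exists u; rewrite fE /= !addr0.
Qed.

End Meet.

(** * Neighborhoods in the topology of pointwise convergence *)

Lemma ptws_discrete_nbhs (X Y : choiceType) (f : X -> Y)
    (O : set {ptws X -> discrete_topology Y}) :
  open O -> O f ->
  exists s : seq X, forall g : X -> Y, {in s, g =1 f} -> O g.
Proof.
move=> oO Of.
(* This filter converges to [f] in each coordinate because points of [Y] are open, hence it
   converges in the product topology and contains [O]. *)
pose G : set_system {ptws X -> discrete_topology Y} :=
  [set B | exists s : seq X, forall g : X -> Y, {in s, g =1 f} -> B g].
have GF : Filter G.
  split=> [|B D [s sB] [t tD]|B D BD [s sB]].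
  - by exists [::].
  - exists (s ++ t) => g gf; split; [apply: sB | apply: tD] => x xs;
      by apply: gf; rewrite mem_cat xs ?orbT.
  - by exists s => g /sB /BD.
have : {ptws, G --> (f : X -> discrete_topology Y)}.
  apply/cvg_sup => x; apply/cvg_image.
    by apply/seteqP; split=> // y _; exists (fun=> y).
  move=> B Bfx; exists (@^~ x @^-1` B).
    exists [:: x] => g gf; rewrite /= gf ?mem_head //.
    exact: nbhs_singleton Bfx.
  by apply/seteqP; split=> [_ [g + <-] //|y By]; exists (fun=> y).
by apply; apply: open_nbhs_nbhs.
Qed.

(** * Open subgroups and subspaces of least dimension *)

Section OpenSubgroups.
Variables (F : fieldType) (Z : lmodType F) (w : cubic_form Z) (e : nat -> Z).
Hypotheses (ebasis : countable_basis e) (uryw : urysohn_extension w).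
Variable H : set (Z -> Z).
Hypothesis subH : isoc_subgroup w H.

Lemma isoc_open_contains_stab :
  isoc_open w H -> exists N, contains_stab w H (@basis_map F Z e N).
Proof.
move=> [O oO HE].
have O1 : O idfun by have [_ + _ _] := subH; rewrite HE => -[].
have [s sO] := ptws_discrete_nbhs oO O1.
have [N NP] : exists N, forall x, x \in s -> exists v : 'rV_N, basis_map e v = x.
  have /choice[n nP] := basis_map_cofinal ebasis.
  exists (\max_(x <- s) n x)%N => x xs; apply: nP.
  exact: leq_bigmax_seq.
exists N => g Ig gN; rewrite HE; split=> //.
by apply: sO => x /NP[v <-]; rewrite gN.
Qed.

(** [H] contains the stabilizers of the range of [a] and of its [h]-translate, hence that of their
    intersection. By minimality this intersection is the whole range. *)
Lemma minimal_stab_invariant n (a : {linear 'rV[F]_n -> Z}) h :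
  injective a -> contains_stab w H a ->
  (forall m (b : {linear 'rV[F]_m -> Z}), injective b ->
     contains_stab w H b -> (n <= m)%N) ->
  H h -> forall x, exists y, h (a y) = a x.
Proof.
move=> ainj Ha nmin Hh.
have [HI _ _ _] := subH; have [hl hb hw] := HI _ Hh.
have [f fE] : exists f : {linear 'rV[F]_n -> Z}, f = h \o a :> ('rV[F]_n -> Z).
  by apply: linear_bundle => k x y; rewrite /= linearP hl.
have [N1 N1P] := basis_map_lift ebasis a.
have [N2 N2P] := basis_map_lift ebasis f.
have [l1 l1E] := N1P (maxn N1 N2) (leq_maxl _ _).
have [l2 l2E] := N2P (maxn N1 N2) (leq_maxr _ _).
set N := maxn N1 N2 in l1 l1E l2 l2E.
pose V := limg (linfun l1); pose W := limg (linfun l2).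
pose i : {linear 'rV[F]_N -> Z} := basis_map e.
have l1inj : injective l1.
  by move=> x y xy; apply: ainj; rewrite -!l1E xy.
have HV : contains_stab w H (fun v : subvs_of V => i (vsval v)).
  apply: contains_stab_sub Ha _ => x; exists (vsproj V (l1 x)).
  rewrite vsprojK; first by rewrite /i /= l1E.
  by rewrite -[l1 x]lfunE memv_img ?memvf.
have HW : contains_stab w H (fun v : subvs_of W => i (vsval v)).
  apply: contains_stab_sub (contains_stab_conj subH Ha Hh) _ => x.
  exists (vsproj W (l2 x)).
  rewrite vsprojK; first by rewrite /i /= l2E fE.
  by rewrite -[l2 x]lfunE memv_img ?memvf.
have HVW := stab_meet ebasis uryw subH (@basis_map_inj _ _ _ ebasis N) HV HW.
have [r [s rK sK]] := rV_vect_bij (subvs_of (V :&: W)%VS).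
(* The left side is [n] by injectivity of [l1]; minimality is applied to the intersection,
   parametrized through [r]. *)
have dVW : (\dim V <= \dim (V :&: W)%VS)%N.
  rewrite dim_limg_linfun // [X in (X <= _)%N]dimvf /dim /=.
  have [b bE] : exists b : {linear 'rV[F]_(\dim {: subvs_of (V :&: W)%VS}) -> Z},
      b = (fun v => i (vsval (r v))) :> (_ -> Z).
    by apply: linear_bundle => k x y; rewrite !linearP.
  rewrite mul1n; apply: leq_trans (nmin _ b _ _) _.
  - rewrite bE => x y /(basis_map_inj ebasis)/val_inj; exact: can_inj rK _ _.
  - rewrite bE; apply: contains_stab_sub HVW _ => v; exists (s v).
    by rewrite sK.
  - by rewrite dimvf.
have VW : (V <= W)%VS.
  have := eqEdim (V :&: W)%VS V; rewrite capvSl dVW => /eqP <-.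
  exact: capvSr.
move=> x; have : l1 x \in W.
  by apply: (subvP VW); rewrite -[l1 x]lfunE memv_img ?memvf.
move=> /memv_imgP[y _ xy]; exists y.
have := l2E y; rewrite fE /= => <-.
by rewrite -l1E xy lfunE.
Qed.

Lemma isoc_open_stab_sandwich : isoc_open w H ->
  exists n (a : {linear 'rV[F]_n -> Z}),
    contains_stab w H a /\ forall h, H h -> h @` range a = range a.
Proof.
move=> /isoc_open_contains_stab[N HN].
pose P n := `[<exists a : {linear 'rV[F]_n -> Z}, injective a /\ contains_stab w H a>].
have exP : exists n, P n.
  by exists N; apply/asboolP; exists (basis_map e); split=> //; apply: basis_map_inj.
have [n /asboolP[a [ainj Ha]] nmin] := ex_minnP exP.
have min m (b : {linear 'rV[F]_m -> Z}) :
    injective b -> contains_stab w H b -> (n <= m)%N.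
  by move=> binj Hb; apply: nmin; apply/asboolP; exists b.
exists n, a; split=> // h Hh.
have [HI _ _ HV] := subH.
have [h' Ih' [hK h'K]] := isoc_inv (HI _ Hh).
have Hh' := HV _ _ Hh hK h'K.
(* Invariance is one inclusion only; the other one comes from applying it to the inverse [h']. *)
apply/seteqP; split=> [_ [_ [x _ <-] <-]|_ [x _ <-]].
  have [y yx] := minimal_stab_invariant ainj Ha min Hh' x.
  by exists y => //; rewrite -yx h'K.
have [y yx] := minimal_stab_invariant ainj Ha min Hh x.
by exists (a y) => //; exists y.
Qed.

End OpenSubgroups.

Lemma range_findim (F : fieldType) (Z : lmodType F) n
    (a : {linear 'rV[F]_n -> Z}) : findim_subspace (range a).
Proof.
split.
  split; first by apply/mem_set; exists 0; rewrite ?linear0.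
  move=> k _ _ /set_mem[x _ <-] /set_mem[y _ <-].
  by apply/mem_set; exists (k *: x + y); rewrite ?linearP.
exists n, (fun i => a (delta_mx 0 i)); split=> [i|_ [x _ <-]].
  by exists (delta_mx 0 i).
exists (fun i => x 0 i); rewrite [in LHS](row_sum_delta x) linear_sum.
by apply: eq_bigr => i _; rewrite linearZ.
Qed.

Theorem theorem3p5 (F : finFieldType) (Z : lmodType F) (w : cubic_form Z)
    (hZ : universal_cubic w) (H : set (Z -> Z))
    (subH : isoc_subgroup w H) (openH : isoc_open w H) :
  exists V : set Z,
    [/\ findim_subspace V,
        pointwise_stab w V `<=` H &
        H `<=` setwise_stab w V].
Proof.
have [[e ebasis] uryw] := hZ.
have [n [a [Ha Hinv]]] := isoc_open_stab_sandwich ebasis uryw subH openH.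
exists (range a); split; first exact: range_findim.
  by move=> g [Ig ga]; apply: Ha => // x; apply: ga; exists x.
have [HI _ _ _] := subH.
by move=> h Hh; split; [apply: HI | apply: Hinv].
Qed.
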